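(* Let $G=(V,E)$ be a graph with edge weights $w:E\to\mathbb{R}_{\ge0}$ and distinct terminals $t_1,\dots,t_k\in V$. Let $\mathrm{OPT}_{frac}$ be the optimum value of the linear program $$\min\ \sum_{e=\{u,v\}\in E} w_e\sum_{i=1}^k\max\{x_u^i,x_v^i\}\quad\text{s.t. } x_u\in\Delta_k\ \forall u\in V,\ \ x_{t_i}=e_i\ \forall i\in[k].$$ Let $S_1,\dots,S_k$ be produced as follows: take an optimal solution $x$ of this LP; choose independent random variables $Z_1,\dots,Z_k$, each exponentially distributed with rate $1$; for each $u\in V$ let $\ell(u)=\arg\min_{i\in[k]} Z_i/x_u^i$; set $S_i=\{u\in V:\ell(u)=i\}$. Then $$\mathbb{E}\Big[\sum_{i=1}^k b(S_i)\Big]\le\frac98\,\mathrm{OPT}_{frac},$$ where $b(S)=\sum_{e\in E:\ e\cap S\ne\emptyset}w_e$.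
   Context: $\Delta_k=\{y\in\mathbb{R}^k:\sum_{i=1}^k y_i=1,\ y\ge0\}$ and $e_i$ is the $i$-th standard unit vector of $\mathbb{R}^k$; $x_u^i$ denotes the $i$-th coordinate of $x_u$. In the definition of $\ell(u)$, $Z_i/0$ is interpreted as $+\infty$ (ties occur with probability zero). *)

(* Defs.v *)
From mathcomp Require Import all_boot all_order all_algebra.
From mathcomp Require Import all_classical all_reals all_analysis.

Set Implicit Arguments.
Unset Strict Implicit.
Unset Printing Implicit Defensive.

Import Order.TTheory GRing.Theory Num.Theory.
Local Open Scope classical_set_scope.
Local Open Scope ring_scope.

Definition simplex (R : realType) (k : nat) : set 'rV[R]_k :=
  [set y | \sum_(i < k) y 0 i = 1 /\ (forall i, 0 <= y 0 i)].

(* A finite simple graph on V is given by its edge set E : {set {set V}}, each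
   edge being a 2-element set of vertices. *)
Definition simple_edges (V : finType) (E : {set {set V}}) : Prop :=
  forall e, e \in E -> #|e| = 2%N.

Section LP.
Variables (R : realType) (V : finType) (k : nat).
Variables (E : {set {set V}}) (w : {set V} -> R) (t : 'I_k -> V).

(* max {x_u^i, x_v^i} for e = {u, v}. The base point 0 of the iterated maximum
   is harmless because simplex coordinates are nonnegative, see
   edge_maxE below. *)
Definition edge_max (x : V -> 'rV[R]_k) (e : {set V}) (i : 'I_k) : R :=
  \big[Num.max/0]_(u in e) x u 0 i.

Definition lp_cost (x : V -> 'rV[R]_k) : R :=
  \sum_(e in E) w e * \sum_(i < k) edge_max x e i.

Definition lp_feasible : set (V -> 'rV[R]_k) :=
  [set x | (forall u, simplex (x u)) /\
           (forall i, x (t i) = delta_mx 0 i)].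

Definition opt_frac : R := inf [set lp_cost x | x in lp_feasible].

Definition lp_optimal (x : V -> 'rV[R]_k) : Prop :=
  lp_feasible x /\ (forall y, lp_feasible y -> lp_cost x <= lp_cost y).

Definition b (S : {set V}) : R := \sum_(e in E | e :&: S != finset.set0) w e.

End LP.

Lemma edge_maxE (R : realType) (V : finType) (k : nat) (x : V -> 'rV[R]_k)
    (u v : V) (i : 'I_k) :
  (forall u, simplex (x u)) ->
  edge_max x [set u; v]%SET i = Num.max (x u 0 i) (x v 0 i).
Proof.
move=> xP; apply/le_anti/andP; split.
  apply: bigmax_le => [|y]; first by rewrite le_max (proj2 (xP u)).
  by rewrite !inE => /orP[] /eqP->; rewrite le_max lexx ?orbT.
rewrite ge_max; apply/andP; split.
  by apply: (le_bigmax_cond _ (fun y => x y 0 i)); rewrite !inE eqxx.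
by apply: (le_bigmax_cond _ (fun y => x y 0 i)); rewrite !inE eqxx orbT.
Qed.

Definition clock_ratio (R : realType) (z a : R) : \bar R :=
  if a == 0 then +oo%E else (z / a)%:E.

(* Ties are broken by the library's choice of a minimizer. The index i0 only
   witnesses that 'I_k is inhabited: the result does not depend on it. *)
Definition label (R : realType) (V : finType) (k : nat) (i0 : 'I_k)
    (x : V -> 'rV[R]_k) (z : 'I_k -> R) (u : V) : 'I_k :=
  [arg min_(i < i0) clock_ratio (z i) (x u 0 i)]%O.

Definition part (R : realType) (V : finType) (k : nat) (i0 : 'I_k)
    (x : V -> 'rV[R]_k) (z : 'I_k -> R) (i : 'I_k) : {set V} :=
  [set u | label i0 x z u == i]%SET.

Definition mutually_independent (R : realType) (d : measure_display)
    (T : measurableType d) (P : probability T R) (I : finType)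
    (Z : I -> {RV P >-> R}) : Prop :=
  forall (J : {set I}) (A : I -> set R), (forall i, measurable (A i)) ->
    P (\bigcap_(i in [set` J]) Z i @^-1` A i) =
    (\prod_(i in J) P (Z i @^-1` A i))%E.

Definition exponentially_distributed (R : realType) (d : measure_display)
    (T : measurableType d) (P : probability T R) (rate : R)
    (X : {RV P >-> R}) : Prop :=
  forall A : set R, measurable A ->
    distribution P X A = exponential_prob rate A.

(* Main.v *)
(* Call i the winner on an edge e = {u, v} when Z_i / m_i < Z_j / M_j for all
   j <> i, where m_i and M_i are the minimum and the maximum of x_u^i and x_v^i.
   Then u and v both get label i, and competing exponential clocks give the
   winner i with probability m_i / (m_i + sum_{j <> i} M_j) >= m_i / s, where
   s = sum_j M_j is the LP cost of e. As sum_i m_i = 2 - s, the edge is split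
   with probability at most 1 - (2 - s) / s, so the expected number of parts
   touching it is at most 3 - 2 / s <= 9 / 8 * s. *)
Require Import Defs.
From mathcomp Require Import all_boot all_order all_algebra.
From mathcomp Require Import all_classical all_reals all_analysis.
From mathcomp Require Import measurable_realfun ring lra.

Import Order.TTheory GRing.Theory Num.Theory.
Import numFieldNormedType.Exports.
Local Open Scope classical_set_scope.
Local Open Scope ring_scope.

(* The integral of a nonnegative function is a supremum over simple functions,
   so neither function has to be measurable. *)
Lemma le_integral_ge0 (R : realType) (d : measure_display)
    (T : measurableType d) (mu : {measure set T -> \bar R}) (f g : T -> \bar R) :
  (forall x, 0 <= f x)%E -> (forall x, f x <= g x)%E ->
  (\int[mu]_x f x <= \int[mu]_x g x)%E.
Proof.
move=> f0 fg; rewrite !ge0_integralTE//; last first.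
  by move=> x; exact: le_trans (f0 x) (fg x).
apply: ereal_sup_le => _ [h /= hf <-]; exists h => //= x.
exact: le_trans (hf x) (fg x).
Qed.

(** * Tails and interval probabilities of an exponential variable *)

Section exponential.
Context (R : realType) (d : measure_display) (T : measurableType d).
Context (P : probability T R) (rate : R) (X : {RV P >-> R}).
Hypothesis (hX : exponentially_distributed rate X).

Lemma exponential_ccdf (a : R) : 0 <= a ->
  P (X @^-1` `]a, +oo[) = (expR (- rate * a))%:E.
Proof.
move=> a0.
have -> : X @^-1` `]a, +oo[ = ~` (X @^-1` `]-oo, a]).
  by rewrite preimage_setC setCitvl.
rewrite probability_setC; last exact: measurable_funPTI.
have -> : P (X @^-1` `]-oo, a]) = exponential_prob rate `]-oo, a].
  exact: hX.
(* The exponential density vanishes on the negative reals. *)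
have -> : exponential_prob rate `]-oo, a] = exponential_prob rate `[0, a].
  rewrite /exponential_prob /exponential_pdf.
  rewrite integral_mkcond [RHS]integral_mkcond; apply: eq_integral => y _.
  rewrite !patchE !mem_setE !in_itv /= andbT.
  by case: (0 <= y) => //=; case: ifP.
(* At [a = 0] the interval is a single point, of mass 0. This case is needed later for the slab with
   [n = 0] and for indices with [c j = 0]. *)
move: a0; rewrite le_eqVlt => /predU1P[<-|a0].
  rewrite mulr0 expR0 /exponential_prob set_itv1 integral_set1; exact: sube0.
rewrite exponential_prob_itv0c//.
by rewrite -!EFinB; congr EFin; ring.
Qed.

Lemma exponential_itv (a b : R) : 0 <= a -> a <= b ->
  P (X @^-1` `]a, b]) = (expR (- rate * a) - expR (- rate * b))%:E.
Proof.
move=> a0 ab.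
have b0 : 0 <= b by exact: le_trans ab.
have : P (X @^-1` `]a, +oo[) =
    (P (X @^-1` `]a, b]) + P (X @^-1` `]b, +oo[))%E.
  rewrite -measureU; [|exact: measurable_funPTI|exact: measurable_funPTI|].
    rewrite -preimage_setU; congr (P (_ @^-1` _)).
    by rewrite -itv_bndbnd_setU ?bnd_simp.
  rewrite -preimage_setI -subset0 => w /=; rewrite !in_itv /= andbT.
  by move=> [/andP[_ h1] h2]; move: (le_lt_trans h1 h2); rewrite ltxx.
by rewrite EFinB -!exponential_ccdf// => ->; rewrite exponential_ccdf// addeK.
Qed.

End exponential.

(** * Competing clocks: the chance that a given index wins *)

Section race.
Context (R : realType) (d : measure_display) (T : measurableType d).
Context (P : probability T R) (I : finType) (Z : I -> {RV P >-> R}).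
Hypothesis hind : mutually_independent Z.
Hypothesis hexp : forall i, exponentially_distributed 1 (Z i).
Variables (c l : I -> R) (i : I).

(* Division-free form of [Z i / l i < Z j / c j], meaningful even if [c j = 0]. *)
Definition wins : set T :=
  [set w | 0 < l i /\ 0 <= Z i w /\ forall j, j != i -> Z i w * c j < l i * Z j w].

Lemma measurable_wins : measurable wins.
Proof.
have [li|li] := pselect (0 < l i); last first.
  rewrite (_ : wins = set0); first exact: measurable0.
  by rewrite -subset0 => w [].
have -> : wins = Z i @^-1` `[0, +oo[ `&`
    \bigcap_(j in [set j | j != i])
      [set w | Z i w * c j < l i * Z j w].
  apply/seteqP; split => w /=; rewrite in_itv /= andbT.
    by move=> [_ [h1 h2]]; split.
  by move=> [h1 h2]; split.
apply: measurableI; first exact: measurable_funPTI.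
apply: fin_bigcap_measurable; [exact: finite_finset|move=> j _].
have mlt : measurable_fun setT (fun w => Z i w * c j < l i * Z j w).
  by apply: measurable_fun_ltr; apply: measurable_funM.
by have := mlt measurableT [set true] Logic.I; rewrite setTI.
Qed.

Hypotheses (li : 0 < l i) (c0 : forall j, 0 <= c j).
Let M := \sum_(j | j != i) c j.

(* Discretizing the value of [Z i / l i] makes the winning probability a
   geometric sum of products, which needs no joint density. *)
Definition slab (h : R) (n : nat) : set T :=
  \bigcap_(j in [set` [set: I]%SET]) Z j @^-1`
    (if j == i then `]l i * (n%:R * h), l i * (n.+1%:R * h)]%classic
     else `]c j * (n.+1%:R * h), +oo[%classic).

(** The grid point [n.+1 * h] separates the clocks: [Z i / l i] is at most it, and every other
    [Z j / c j] exceeds it. *)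
Lemma slab_wins h n : 0 < h -> slab h n `<=` wins.
Proof.
move=> h0 w hw; have ith j : _ := hw j (finset.in_setT j).
have := ith i; rewrite /= eqxx /= in_itv /= => /andP[lo hi].
split => //; split.
  by apply: le_trans (ltW lo); rewrite !mulr_ge0 // ltW.
move=> j ji; have := ith j; rewrite /= (negbTE ji) /= in_itv /= andbT => hj.
apply: (@le_lt_trans _ _ (l i * (n.+1%:R * h) * c j)).
  by rewrite ler_wpM2r.
by rewrite -mulrA ltr_pM2l// mulrC.
Qed.

Lemma measurable_slab h n : measurable (slab h n).
Proof.
apply: fin_bigcap_measurable; first exact: finite_finset.
by move=> j _; case: ifP => _; exact: measurable_funPTI.
Qed.

Lemma trivIset_slab h : 0 < h -> trivIset setT (slab h).
Proof.
move=> h0; apply: ltn_trivIset => m n mn.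
rewrite -subset0 => w [hm hn].
have := hm i (finset.in_setT i); have := hn i (finset.in_setT i).
rewrite /= eqxx /= !in_itv /= => /andP[h1 _] /andP[_ h2].
have := lt_le_trans h1 h2; apply/negP; rewrite -leNgt.
by rewrite ler_pM2l// ler_pM2r// ler_nat.
Qed.

(** By independence the tails of the [Z j] with [j != i] multiply to [expR (- (M * (n.+1 * h)))],
    and the interval for [Z i] contributes a difference of two exponentials. Moving from [n] to
    [n.+1] scales the product by [expR (- ((l i + M) * h))]. *)
Lemma prob_slab h n : 0 < h ->
  P (slab h n) =
  ((expR (- (M * h)) - expR (- ((l i + M) * h))) *
   expR (- ((l i + M) * h)) ^+ n)%:E.
Proof.
move=> h0; rewrite hind; last by move=> j; case: ifP.
have nh m : 0 <= m%:R * h by rewrite mulr_ge0// ltW.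
rewrite (bigD1 i) ?inE//= eqxx (exponential_itv _ _ _ _ _ _ (hexp i)); first last.
- by rewrite ler_pM2l// ler_pM2r// ler_nat.
- by rewrite mulr_ge0// ltW.
under eq_bigr => j /andP[_ ji].
  rewrite (negbTE ji).
  rewrite (exponential_ccdf _ _ _ _ _ _ (hexp j) _ (mulr_ge0 (c0 j) (nh n.+1))).
  over.
rewrite /= prodEFin -expR_sum -EFinM; congr EFin.
rewrite (_ : \sum_(j in [set: I]%SET | j != i) - 1 * (c j * (n.+1%:R * h)) =
   - (M * (n.+1%:R * h))); last first.
  rewrite /M mulr_suml -sumrN; apply: eq_big => [j|j _]; first by rewrite inE.
  by rewrite mulN1r.
rewrite -expRM_natl !mulrBl -!expRD -natr1; congr (_ - _); congr expR; ring.
Qed.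

(** The slabs are disjoint events inside [wins], so their geometric series [K / (1 - q)] is a lower
    bound. The first [N] slabs give a finite sum, and then [N] tends to infinity. *)
Lemma wins_ge_slabs h : 0 < h ->
  expR (- (M * h)) - expR (- ((l i + M) * h)) <=
  fine (P wins) * (1 - expR (- ((l i + M) * h))).
Proof.
move=> h0; set q := expR (- ((l i + M) * h)); set K := _ - q.
have M0 : 0 <= M by exact: sumr_ge0.
have q1 : q < 1 by rewrite -expR0 ltr_expR oppr_lt0 mulr_gt0// ltr_pwDl.
have q0 : 0 < q by exact: expR_gt0.
have partial N : K * (1 - q ^+ N) <= fine (P wins) * (1 - q).
  have /fine_le : (P (\bigcup_(n in `I_N) slab h n) <= P wins)%E.
    apply: le_measure; rewrite ?inE; [|exact: measurable_wins|].
      by apply: bigcup_measurable => n _; exact: measurable_slab.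
    by move=> w [n _]; exact: slab_wins.
  rewrite measure_fin_bigcup//; first last.
  - by move=> n _; exact: measurable_slab.
  - exact: sub_trivIset (trivIset_slab h h0).
  rewrite -fsbig_ord.
  rewrite (eq_bigr (fun n : 'I_N => (K * q ^+ n)%:E)); last first.
    by move=> n _; exact: prob_slab.
  rewrite sumEFin /= -mulr_sumr => le.
  have {}le := le isT (fin_num_measure P _ measurable_wins).
  have -> : 1 - q ^+ N = (1 - q) * \sum_(j < N) q ^+ j.
    rewrite -[1 in LHS](expr1n _ N) subrXX; congr (_ * _).
    by apply: eq_bigr => j _; rewrite expr1n mul1r.
  by rewrite mulrCA mulrC ler_wpM2r// subr_ge0 ltW.
have cv : K * (1 - q ^+ N) @[N --> \oo] --> K.
  rewrite -[K in _ --> K]mulr1 -[in X in _ --> X](subr0 1).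
  apply: cvgMl_tmp; apply: cvgB; first exact: cvg_cst.
  by apply: cvg_expr; rewrite ger0_norm// ltW.
apply: (cvgr_to_le cv); exact: nearW.
Qed.

Lemma prob_wins_ge_pos : l i / (l i + M) <= fine (P wins).
Proof.
have M0 : 0 <= M by exact: sumr_ge0.
have S0 : 0 < l i + M by rewrite ltr_pwDl.
have p0 : 0 <= fine (P wins) by rewrite fine_ge0.
rewrite ler_pdivrMr// mulrC; apply/ler_addgt0Pr => e e0.
(* Instead of letting [h] tend to 0, fix it so that the second-order error [l i * (l i + M) * h] is
   exactly [e]. The estimates below use only [1 + y <= expR y]. *)
pose h := e / (l i * (l i + M)).
have h0 : 0 < h by rewrite divr_gt0// mulr_gt0.
have key := wins_ge_slabs h h0.
have h1 : 1 - expR (- ((l i + M) * h)) <= (l i + M) * h.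
  by have := expR_ge1Dx (- ((l i + M) * h)); lra.
have h2 : expR (- ((l i + M) * h)) * (l i * h) <=
    expR (- (M * h)) - expR (- ((l i + M) * h)).
  rewrite (_ : - (M * h) = - ((l i + M) * h) + l i * h); last by ring.
  rewrite expRD; have := expR_ge1Dx (l i * h); have := expR_gt0 (- ((l i + M) * h)).
  nra.
have h3 : (1 - (l i + M) * h) * (l i * h) <= expR (- ((l i + M) * h)) * (l i * h).
  apply: ler_wpM2r; last exact: expR_ge1Dx.
  by rewrite mulr_ge0// ltW.
have h4 : fine (P wins) * (1 - expR (- ((l i + M) * h))) <= fine (P wins) * ((l i + M) * h).
  by rewrite ler_wpM2l.
have h5 : (l i - e) * h <= ((l i + M) * fine (P wins)) * h.
  have e1 : e = l i * ((l i + M) * h) by rewrite /h; field; rewrite !gt_eqF.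
  by rewrite [X in l i - X]e1; lra.
move: h5; rewrite ler_pM2r//; lra.
Qed.

End race.

Arguments wins {R d T P I} Z c l i.

(** * The chance that some index wins *)

Section race_corollaries.
Context (R : realType) (d : measure_display) (T : measurableType d).
Context (P : probability T R) (I : finType) (Z : I -> {RV P >-> R}).
Hypothesis hind : mutually_independent Z.
Hypothesis hexp : forall i, exponentially_distributed 1 (Z i).
Variables (c l : I -> R).
Hypotheses (l0 : forall i, 0 <= l i) (lc : forall i, l i <= c i).

Lemma prob_wins_ge i :
  l i / \sum_j c j <= fine (P (wins Z c l i)).
Proof.
have c0 j : 0 <= c j by exact: le_trans (lc j).
have [li|li] := ltP 0 (l i); last first.
  have -> : l i = 0 by apply/le_anti; rewrite li l0.
  by rewrite mul0r fine_ge0.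
have M0 : 0 <= \sum_(j | j != i) c j by exact: sumr_ge0.
apply: le_trans (prob_wins_ge_pos _ _ _ _ _ _ hind hexp _ _ _ li c0).
rewrite [X in _ / X](bigD1 i)//= ler_wpM2l// lef_pV2 ?posrE.
- by rewrite lerD2r.
- by rewrite ltr_wpDr// (lt_le_trans li).
- by rewrite ltr_wpDr.
Qed.

Definition someone_wins : set T := \bigcup_i wins Z c l i.

Lemma measurable_someone_wins : measurable someone_wins.
Proof.
apply: fin_bigcup_measurable; first exact: finite_finset.
by move=> i _; exact: measurable_wins.
Qed.

(** Two winners [i] and [j] would give the cycle [Z i * c j < l i * Z j <= c i * Z j < l j * Z i <=
    c j * Z i]. The weak inequalities use [l <= c] and the nonnegativity of the winning clocks. *)
Lemma trivIset_wins : trivIset setT (wins Z c l).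
Proof.
apply/trivIsetP => i j _ _ ij; rewrite -subset0 => w.
move=> [[li [zi hi]] [lj [zj hj]]].
have := hi j; rewrite eq_sym ij => /(_ isT) h1.
have := hj i ij => h2.
have h3 : l i * Z j w <= Z j w * c i by rewrite mulrC ler_wpM2l.
have h4 : l j * Z i w <= Z i w * c j by rewrite mulrC ler_wpM2l.
by move: (lt_le_trans h1 (le_trans h3 (le_trans (ltW h2) h4))); rewrite ltxx.
Qed.

Lemma prob_someone_wins :
  (\sum_i l i) / (\sum_i c i) <= fine (P someone_wins).
Proof.
have -> : P someone_wins = (\sum_i P (wins Z c l i))%E.
  rewrite /someone_wins.
  have -> : [set: I] = [set` index_enum I].
    by apply/seteqP; split => // i _ /=; rewrite mem_index_enum.
  rewrite measure_fin_bigcup//.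
  - by rewrite -fsbig_seq// index_enum_uniq.
  - exact: sub_trivIset trivIset_wins.
  - by move=> i _; exact: measurable_wins.
rewrite -sum_fine; last by move=> i _; apply: fin_num_measure; exact: measurable_wins.
by rewrite mulr_suml; apply: ler_sum => i _; exact: prob_wins_ge.
Qed.

End race_corollaries.

Arguments someone_wins {R d T P I} Z c l.

(** * From winning an edge to the labels of its endpoints *)

(** A strict minimizer is unaffected by the tie-breaking rule and by [i0]. *)
Lemma label_unique_min (R : realType) (V : finType) (k : nat) (i0 i : 'I_k)
    (x : V -> 'rV[R]_k) (z : 'I_k -> R) (u : V) :
  (forall j, j != i ->
    (clock_ratio (z i) (x u 0%R i) < clock_ratio (z j) (x u 0%R j))%E) ->
  label i0 x z u = i.
Proof.
move=> hlt; rewrite /label; case: arg_minP => //= j _ /(_ i isT) hj.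
by apply/eqP; apply: contraTT hj => /hlt; rewrite -ltNge.
Qed.

Section edge.
Context (R : realType) (V : finType) (k : nat) (x : V -> 'rV[R]_k).
Hypothesis xP : forall u, simplex (x u).

(** For two endpoints, sum minus maximum is the minimum. In this form the total over [i] is
    immediately 2 minus the LP cost of the edge, and no base point for an iterated minimum is
    needed. *)
Definition edge_min (e : {set V}) (i : 'I_k) : R :=
  \sum_(u in e) x u 0 i - edge_max x e i.

Lemma le_edge_max (e : {set V}) u i : u \in e -> x u 0 i <= edge_max x e i.
Proof. by move=> ue; apply: (le_bigmax_cond _ (fun v => x v 0 i)). Qed.

Lemma edge_minE (u v : V) i : u != v ->
  edge_min [set u; v]%SET i = Num.min (x u 0 i) (x v 0 i).
Proof.
move=> uv; rewrite /edge_min edge_maxE// big_setU1 ?inE// big_set1.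
by rewrite /= -(addr_min_max (x u 0 i)) addrK.
Qed.

Variable e : {set V}.
Hypothesis he : #|e| = 2%N.

Lemma edge_min_le u i : u \in e -> edge_min e i <= x u 0 i.
Proof.
move/eqP/cards2P: he => [a [b [ab ->]]]; rewrite edge_minE// !inE.
by move=> /orP[] /eqP ->; rewrite ge_min lexx ?orbT.
Qed.

Lemma edge_min_ge0 i : 0 <= edge_min e i.
Proof.
move/eqP/cards2P: he => [a [b [ab ->]]]; rewrite edge_minE// le_min.
by rewrite (proj2 (xP a)) (proj2 (xP b)).
Qed.

Lemma edge_min_le_max i : edge_min e i <= edge_max x e i.
Proof.
have /card_gt0P[u ue] : (0 < #|e|)%N by rewrite he.
exact: le_trans (edge_min_le _ i ue) (le_edge_max _ _ i ue).
Qed.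

Lemma sum_edge_max_ge1 : 1 <= \sum_i edge_max x e i.
Proof.
have /card_gt0P[u ue] : (0 < #|e|)%N by rewrite he.
by rewrite -(proj1 (xP u)); apply: ler_sum => i _; exact: le_edge_max.
Qed.

Lemma sum_edge_min : \sum_i edge_min e i = 2 - \sum_i edge_max x e i.
Proof.
rewrite /edge_min sumrB exchange_big /=; congr (_ - _).
by rewrite (eq_bigr (fun=> 1)) ?sumr_const ?he// => u _; exact: proj1 (xP u).
Qed.

(** For both endpoints, [Z i / x_u^i <= Z i / m_i < Z j / M_j <= Z j / x_u^j], with [m] the edge
    minimum and [M] the edge maximum. *)
Lemma wins_label (d : measure_display) (T : measurableType d)
    (P : probability T R) (Z : 'I_k -> {RV P >-> R}) (i0 i : 'I_k) w u :
  wins Z (edge_max x e) (edge_min e) i w -> u \in e ->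
  label i0 x (fun j => Z j w) u = i.
Proof.
move=> [li [zi hi]] ue; apply: label_unique_min => j ji.
have xi : 0 < x u 0 i by exact: lt_le_trans li (edge_min_le _ _ ue).
have hj := hi j ji.
have cj : x u 0 j <= edge_max x e j by exact: le_edge_max.
(* Only the winner's clock is nonnegative by definition; its strict inequality forces the same for
   the others. *)
have zj : 0 <= Z j w.
  rewrite -(pmulr_rge0 _ li); apply: le_trans (ltW hj).
  by rewrite mulr_ge0// (le_trans _ cj)// (proj2 (xP u)).
rewrite /clock_ratio gt_eqF//; case: eqVneq => [_|xj]; first exact: ltry.
have {}xj : 0 < x u 0 j by rewrite lt_neqAle eq_sym xj (proj2 (xP u)).
rewrite lte_fin ltr_pdivrMr// mulrAC ltr_pdivlMr//.
apply: (@le_lt_trans _ _ (Z i w * edge_max x e j)); first by rewrite ler_wpM2l.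
by apply: (lt_le_trans hj); rewrite mulrC ler_wpM2l// edge_min_le.
Qed.

End edge.

Arguments edge_min {R V k} x e i.

(** * Counting the parts that meet an edge *)

Section parts.
Context (R : realType) (V : finType) (k : nat) (i0 : 'I_k).
Variables (E : {set {set V}}) (w : {set V} -> R).
Variables (x : V -> 'rV[R]_k) (z : 'I_k -> R).

(** Double counting: [e] contributes [w e] to [b] of part [i] exactly when some endpoint has label
    [i]. *)
Lemma sum_b_part :
  \sum_i b E w (part i0 x z i) =
  \sum_(e in E) w e * #|label i0 x z @: e|%:R.
Proof.
rewrite /b; under eq_bigr do rewrite big_mkcondr.
rewrite exchange_big /=; apply: eq_bigr => e _.
rewrite -big_mkcond sumr_const mulr_natr; congr (_ *+ _).
apply: eq_card => i; apply/idP/imsetP => [/finset.set0Pn[u]|[u ue ->]].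
  by rewrite !inE => /andP[ue /eqP <-]; exists u.
by apply/finset.set0Pn; exists u; rewrite !inE ue eqxx.
Qed.

Lemma card_label_const (e : {set V}) i :
  (forall u, u \in e -> label i0 x z u = i) -> (#|label i0 x z @: e| <= 1)%N.
Proof.
move=> hl; rewrite -(cards1 i); apply: subset_leq_card.
by apply/fintype.subsetP => _ /imsetP[u ue ->]; rewrite inE hl.
Qed.

End parts.

(** * The LP optimum and the expected cost *)

Lemma opt_frac_optimal (R : realType) (V : finType) (k : nat)
    (E : {set {set V}}) (w : {set V} -> R) (t : 'I_k -> V) (x : V -> 'rV[R]_k) :
  lp_optimal E w t x -> opt_frac E w t = lp_cost E w x.
Proof.
move=> [xf xopt]; apply/le_anti/andP; split.
  apply: ge_inf; last by exists x.
  (* A real [inf] lies below the members of a set only if the set is bounded below; optimality of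
     [x] supplies the bound. *)
  by exists (lp_cost E w x) => _ [y yf <-]; exact: xopt.
by apply: lb_le_inf; [exists (lp_cost E w x), x|move=> _ [y yf <-]; exact: xopt].
Qed.

Theorem theorem3p1 (R : realType) (V : finType) (E : {set {set V}})
    (w : {set V} -> R) (k : nat) (hk : (0 < k)%N) (t : 'I_k -> V)
    (hE : simple_edges E)
    (hw : forall e, e \in E -> 0 <= w e)
    (ht : injective t)
    (x : V -> 'rV[R]_k) (hx : lp_optimal E w t x)
    (d : measure_display) (T : measurableType d) (P : probability T R)
    (Z : 'I_k -> {RV P >-> R})
    (hind : mutually_independent Z)
    (hexp : forall i, exponentially_distributed 1 (Z i)) :
  ('E_P[fun omega =>
          (\sum_(i < k) b E w (part (Ordinal hk) x (fun j => Z j omega) i))%R]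
   <= (9 / 8 * opt_frac E w t)%R%:E)%E.
Proof.
rewrite (opt_frac_optimal _ _ _ _ _ _ _ hx).
have xP : forall u, simplex (x u) by exact: hx.1.1.
rewrite unlock.
pose A e := someone_wins Z (edge_max x e) (edge_min x e).
have mA e : measurable (A e) by exact: measurable_someone_wins.
(* A measurable majorant of the cost: an edge counts once if someone wins on it and twice otherwise.
   The absolute value keeps the summand nonnegative for every [e], since the sign of [w] is known
   only on [E]. *)
pose g omega := (\sum_(e <- enum E) `|w e|%:E * (1 + \1_(~` A e) omega)%:E)%E.
apply: (@le_trans _ _ (\int[P]_omega g omega)%E).
  apply: le_integral_ge0 => omega.
    rewrite lee_fin sum_b_part; apply: sumr_ge0 => e eE.
    by rewrite mulr_ge0// hw.
  rewrite /g big_enum sum_b_part -sumEFin; apply: lee_sum => e eE.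
  rewrite -EFinM lee_fin ger0_norm ?hw// ler_wpM2l ?hw//.
  rewrite indicE; case: (asboolP (A e omega)) => [Ae|nAe].
    rewrite memNset ?addr0; last by move=> /(_ Ae).
    rewrite -[1]/(1%:R) ler_nat; case: Ae => i _ hi.
    apply: (card_label_const _ _ _ _ _ _ _ i) => u.
    by apply: wins_label hi; rewrite ?hE.
  (* Without a winner, the two endpoints carry at most two labels. *)
  rewrite mem_set// -[1 + _]/(2%:R) ler_nat -(hE e eE).
  exact: leq_imset_card.
have m1 e : measurable_fun setT (fun omega => (1 + \1_(~` A e) omega)%:E : \bar R).
  apply/measurable_EFinP; apply: measurable_funD => //.
  exact/measurable_indicP/measurableC.
have ge0_1 e omega : (0 <= (1 + \1_(~` A e) omega)%:E :> \bar R)%E.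
  by rewrite lee_fin addr_ge0.
rewrite ge0_integral_sum//; last by move=> e; exact: measurable_funeM.
rewrite big_enum /lp_cost mulr_sumr -sumEFin; apply: lee_sum => e eE.
rewrite ge0_integralZl//.
under eq_integral do rewrite EFinD.
rewrite ge0_integralD//; last first.
  exact/measurable_EFinP/measurable_indicP/measurableC.
have -> : (\int[P]__ 1 = 1)%E.
  by rewrite integral_cst// mul1e; exact: probability_setT.
have -> : (\int[P]_omega (\1_(~` A e) omega)%:E = (1 - fine (P (A e)))%:E)%E.
  rewrite integral_indic//; last exact: measurableC.
  rewrite setIT EFinB fineK; last exact: fin_num_measure.
  exact: probability_setC.
(* Cancelling [w e] leaves the bound for one edge, [1 + (1 - p) <= 9 / 8 * s], where [p] is the
   probability that someone wins and [s] is the LP cost of the edge. *)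
rewrite -EFinD -EFinM lee_fin mulrCA ger0_norm ?hw// ler_wpM2l ?hw//.
have he := hE e eE.
have hp := prob_someone_wins _ _ _ _ _ _ hind hexp _ _
  (edge_min_ge0 _ _ _ _ xP _ he) (edge_min_le_max _ _ _ _ xP _ he).
move: hp; rewrite (sum_edge_min _ _ _ _ xP _ he) -/(A e).
have := sum_edge_max_ge1 _ _ _ _ xP _ he.
set s := \sum_i _ => s1; rewrite ler_pdivrMr; last by lra.
set p := fine _ => hp.
(* [3 - 2 / s <= 9 / 8 * s] is [0 <= (3 * s - 4) ^ 2]. *)
rewrite -(@ler_pM2r _ s); last by lra.
have := sqr_ge0 (3 * s - 4); nra.
Qed.
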